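(* Let $u$ be the solution of $$u_t=u_{xx},\quad 0<x<a,\ 0<t<T,$$ $$u_x(0,t)=u^{-p}(0,t),\quad u_x(a,t)=(1-u(a,t))^{-q},\quad 0<t<T,$$ $$u(x,0)=u_0(x),\quad 0\le x\le a,$$ with quenching time $T$. If $u_0$ satisfies $u_{xx}(x,0)\le 0$ for $0<x<a$, then there exists a positive constant $C_3$ such that $$u(0,t)\ge C_3(T-t)^{1/(2p+2)}$$ for $t$ sufficiently close to the quenching time $T$.
   Context: Standing assumptions: $a,p,q>0$ are constants. The initial function $u_0$ is a non-negative smooth function on $[0,a]$ satisfying the compatibility conditions $u_0'(0)=u_0^{-p}(0)$ and $u_0'(a)=(1-u_0(a))^{-q}$. The quenching time of the solution is the finite time $T=T(u_0)<\infty$ such that $\lim_{t\to T^-}\min\{u(x,t):0\le x\le a\}=0$ or $\lim_{t\to T^-}\max\{u(x,t):0\le x\le a\}=1$. *)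

(* Defs.v *)
From Stdlib Require Import Reals.
From Coquelicot Require Import Coquelicot.
Open Scope R_scope.

(** Derivative relative to a set [D]: one-sided at an end point of an interval,
    the ordinary derivative at an interior point. *)
Definition is_derive_on (D : R -> Prop) (f : R -> R) (x l : R) : Prop :=
  filterlim (fun y => (f y - f x) / (y - x)) (within D (locally' x)) (locally l).

Definition space (a x : R) : Prop := 0 <= x <= a.
Definition time (T t : R) : Prop := 0 <= t < T.

Definition continuous_on_cylinder (a T : R) (g : R -> R -> R) : Prop :=
  forall x t, space a x -> time T t ->
    filterlim (fun z : R * R => g (fst z) (snd z))
      (within (fun z : R * R => space a (fst z) /\ time T (snd z)) (locally (x, t)))
      (locally (g x t)).

(** [u] belongs to [C^{2,1}([0,a] x [0,T))], with partial derivatives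
    [ux], [uxx] and [ut]. *)
Definition is_C21 (a T : R) (u ux uxx ut : R -> R -> R) : Prop :=
  (forall x t, space a x -> time T t ->
     is_derive_on (space a) (fun y => u y t) x (ux x t) /\
     is_derive_on (space a) (fun y => ux y t) x (uxx x t) /\
     is_derive_on (time T) (fun s => u x s) t (ut x t)) /\
  continuous_on_cylinder a T u /\
  continuous_on_cylinder a T ux /\
  continuous_on_cylinder a T uxx /\
  continuous_on_cylinder a T ut.

Definition smooth_on_segment (a : R) (f : R -> R) : Prop :=
  exists D : nat -> R -> R,
    (forall x, space a x -> D 0%nat x = f x) /\
    (forall n x, space a x -> is_derive_on (space a) (D n) x (D (S n) x)).

(** [0 < u0 0] and [u0 a < 1] are what gives the two negative powers a meaning:
    [Rpower x y] is [x^y] only for [0 < x]. *)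
Definition initial_datum (a p q : R) (u0 : R -> R) : Prop :=
  smooth_on_segment a u0 /\
  (forall x, space a x -> 0 <= u0 x) /\
  0 < u0 0 /\ u0 a < 1 /\
  is_derive_on (space a) u0 0 (Rpower (u0 0) (- p)) /\
  is_derive_on (space a) u0 a (Rpower (1 - u0 a) (- q)).

Definition is_solution (a p q T : R) (u0 : R -> R) (u : R -> R -> R) : Prop :=
  exists ux uxx ut : R -> R -> R,
    is_C21 a T u ux uxx ut /\
    (forall x t, 0 < x < a -> 0 < t < T -> ut x t = uxx x t) /\
    (forall t, 0 < t < T -> ux 0 t = Rpower (u 0 t) (- p)) /\
    (forall t, 0 < t < T -> ux a t = Rpower (1 - u a t) (- q)) /\
    (forall x, space a x -> u x 0 = u0 x).

Definition is_min_on (D : R -> Prop) (f : R -> R) (m : R) : Prop :=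
  (exists x, D x /\ f x = m) /\ forall x, D x -> m <= f x.

Definition is_max_on (D : R -> Prop) (f : R -> R) (m : R) : Prop :=
  (exists x, D x /\ f x = m) /\ forall x, D x -> f x <= m.

(** The bounds [0 < u < 1] express that no quenching occurs before [T]. *)
Definition is_quenching_time (a T : R) (u : R -> R -> R) : Prop :=
  0 < T /\
  (forall x t, space a x -> 0 < t < T -> 0 < u x t < 1) /\
  ((exists m : R -> R,
      (forall t, 0 < t < T -> is_min_on (space a) (fun x => u x t) (m t)) /\
      filterlim m (at_left T) (locally 0)) \/
   (exists m : R -> R,
      (forall t, 0 < t < T -> is_max_on (space a) (fun x => u x t) (m t)) /\
      filterlim m (at_left T) (locally 1))).

(* Main.v *)
Require Import Defs.
From Stdlib Require Import Reals Lra Classical ClassicalEpsilon.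
From Coquelicot Require Import Coquelicot.
Open Scope R_scope.

(** Comparing [u] with [u0], and then with its own time translates, gives [ut <= 0], so that [u] is
    concave in [x].  With [k = (2p+1)/p] and [c = p/k], the function [J = ut + c ux^k] is a
    subsolution of the heat equation, as [z^k] is convex.  At [x = 0], where [ux = u^(-p)], the
    terms [- p u^(-p-1) ut] and [c k ux^(k-1) uxx = p u^(-p-1) ut] of [Jx] cancel, and [Jx <= 0] at
    [x = a]; hence [J] is at most its initial maximum, which by [ut <= 0] and concavity is at most
    [c u(0,tau)^(-2p-1)].  At [x = 0] this reads [ut <= c (A - u^(-2p-1))], which, once [u(0,t)] is
    small, integrates to [u^(2p+2) >= c (p+1) (T-t)]; if [u(0,t)] never gets small there is nothing
    to prove.  As [J] need not be differentiable, [ut] and [ux] are replaced in it by difference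
    quotients in [t] and [x], at the price of arbitrarily small errors in the boundary conditions. *)

(** * One-sided derivatives and clamping *)

Definition clamp (lo hi x : R) : R := Rmax lo (Rmin hi x).

Lemma clamp_id (lo hi x : R) : lo <= x <= hi -> clamp lo hi x = x.
Proof. intros; unfold clamp; rewrite Rmin_right, Rmax_right; lra. Qed.

Lemma clamp_lo (lo hi x : R) : lo <= hi -> x <= lo -> clamp lo hi x = lo.
Proof. intros; unfold clamp; rewrite Rmin_right, Rmax_left; lra. Qed.

Lemma clamp_hi (lo hi x : R) : lo <= hi -> hi <= x -> clamp lo hi x = hi.
Proof. intros; unfold clamp; rewrite Rmin_left, Rmax_right; lra. Qed.

Lemma clamp_bounds (lo hi x : R) : lo <= hi -> lo <= clamp lo hi x <= hi.
Proof.
intros; unfold clamp; split; [apply Rmax_l|].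
apply Rmax_lub; [lra | apply Rmin_l].
Qed.

Lemma clamp_dist (lo hi x y : R) : Rabs (clamp lo hi x - clamp lo hi y) <= Rabs (x - y).
Proof.
unfold clamp, Rmax, Rmin.
repeat destruct (Rle_dec _ _); unfold Rabs; repeat destruct (Rcase_abs _); lra.
Qed.

Lemma is_derive_onE (D : R -> Prop) (f : R -> R) (x l : R) :
  is_derive_on D f x l ->
  forall eps : posreal, exists d : posreal, forall y,
    D y -> y <> x -> Rabs (y - x) < d -> Rabs ((f y - f x) / (y - x) - l) < eps.
Proof.
intros H eps.
destruct (proj1 (filterlim_locally _ _) H eps) as [d Hd].
exists d; intros y Dy yx yd; exact (Hd y yd yx Dy).
Qed.

Lemma is_derive_slope (f : R -> R) (x l : R) :
  (forall eps : posreal, exists d : posreal, forall y,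
    y <> x -> Rabs (y - x) < d -> Rabs ((f y - f x) / (y - x) - l) < eps) ->
  is_derive f x l.
Proof.
intros H; apply is_derive_Reals; intros eps e0.
destruct (H (mkposreal eps e0)) as [d Hd].
exists d; intros h h0 hd.
generalize (Hd (x + h)); replace (x + h - x) with h by ring.
intros A; apply A; [lra | exact hd].
Qed.

Lemma is_derive_on_interior (D : R -> Prop) (f : R -> R) (x l : R) :
  locally x D -> is_derive_on D f x l -> is_derive f x l.
Proof.
intros [r Hr] H; apply is_derive_slope; intros eps.
destruct (is_derive_onE _ _ _ _ H eps) as [d Hd].
exists (mkposreal _ (Rmin_stable_in_posreal r d)); simpl; intros y yx yd.
apply Hd; [apply Hr | exact yx |]; 
  eapply Rlt_le_trans; [exact yd | apply Rmin_l | exact yd | apply Rmin_r].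
Qed.

Lemma locally_segment (lo hi x : R) : lo < x < hi -> locally x (fun y => lo <= y <= hi).
Proof.
intros [H1 H2]; apply filter_and.
- apply filter_imp with (2 := open_gt lo x H1); intros; lra.
- apply filter_imp with (2 := open_lt hi x H2); intros; lra.
Qed.

Lemma is_derive_on_unique (a : R) (f : R -> R) (x l1 l2 : R) :
  0 < a -> space a x ->
  is_derive_on (space a) f x l1 -> is_derive_on (space a) f x l2 -> l1 = l2.
Proof.
intros a0 [x0 xa] H1 H2.
destruct (Req_dec l1 l2) as [E | N]; [exact E | exfalso].
assert (e0 : 0 < Rabs (l1 - l2) / 2).
{ assert (0 < Rabs (l1 - l2)) by (apply Rabs_pos_lt; lra); lra. }
destruct (is_derive_onE _ _ _ _ H1 (mkposreal _ e0)) as [d1 Hd1].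
destruct (is_derive_onE _ _ _ _ H2 (mkposreal _ e0)) as [d2 Hd2].
assert (Y : exists y, space a y /\ y <> x /\ Rabs (y - x) < d1 /\ Rabs (y - x) < d2).
{ set (r := Rmin (Rmin d1 d2) a / 2).
  assert (0 < r < d1 /\ r < d2 /\ r <= a / 2) as [? [? ?]].
  { unfold r; generalize (cond_pos d1) (cond_pos d2); intros.
    unfold Rmin; repeat destruct (Rle_dec _ _); lra. }
  destruct (Rle_dec x (a / 2)).
  - exists (x + r); unfold space; rewrite Rabs_pos_eq; repeat split; lra.
  - exists (x - r); unfold space; rewrite Rabs_left; repeat split; lra. }
destruct Y as [y [Dy [yx [y1 y2]]]].
generalize (Hd1 y Dy yx y1) (Hd2 y Dy yx y2); simpl.
generalize ((f y - f x) / (y - x)); intros s.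
unfold Rabs; repeat destruct (Rcase_abs _); lra.
Qed.

(* Continuing [f] by its tangents at the end points makes the one-sided derivatives two-sided. *)
Lemma is_derive_tangent_ext (a : R) (f f' : R -> R) :
  0 < a -> (forall x, space a x -> is_derive_on (space a) f x (f' x)) ->
  forall x, is_derive (fun y => f (clamp 0 a y) + f' (clamp 0 a y) * (y - clamp 0 a y))
              x (f' (clamp 0 a x)).
Proof.
intros a0 H x.
destruct (Rlt_dec x 0) as [x0 | x0].
{ apply is_derive_ext_loc with (fun y => f 0 + f' 0 * (y - 0)).
  - apply filter_imp with (2 := open_lt 0 x x0); intros y y0.
    rewrite clamp_lo by lra; reflexivity.
  - rewrite clamp_lo by lra; auto_derive; [trivial | ring]. }
destruct (Rlt_dec a x) as [xa | xa].
{ apply is_derive_ext_loc with (fun y => f a + f' a * (y - a)).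
  - apply filter_imp with (2 := open_gt a x xa); intros y y0.
    rewrite clamp_hi by lra; reflexivity.
  - rewrite clamp_hi by lra; auto_derive; [trivial | ring]. }
rewrite clamp_id by lra.
assert (Hx : space a x) by (unfold space; lra).
apply is_derive_slope; intros eps.
destruct (is_derive_onE _ _ _ _ (H x Hx) eps) as [d Hd].
assert (r0 : 0 < Rmin d (Rmin (if Req_dec_T x 0 then 1 else x) (if Req_dec_T x a then 1 else a - x))).
{ repeat apply Rmin_pos; [apply cond_pos | |]; destruct (Req_dec_T _ _); lra. }
exists (mkposreal _ r0); simpl; intros y yx yd.
apply Rmin_Rgt_l in yd; destruct yd as [yd yr].
apply Rmin_Rgt_l in yr; destruct yr as [y1 y2].
rewrite (clamp_id 0 a x) by lra.
destruct (Rlt_dec y 0) as [y0 | y0].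
{ destruct (Req_dec_T x 0) as [E | N].
  - subst x; rewrite clamp_lo by lra.
    replace (_ - f' 0) with 0 by (field; lra); rewrite Rabs_R0; apply cond_pos.
  - exfalso; revert y1; unfold Rabs; destruct (Rcase_abs _); lra. }
destruct (Rlt_dec a y) as [ya | ya].
{ destruct (Req_dec_T x a) as [E | N].
  - subst x; rewrite clamp_hi by lra.
    replace (_ - f' a) with 0 by (field; lra); rewrite Rabs_R0; apply cond_pos.
  - exfalso; revert y2; unfold Rabs; destruct (Rcase_abs _); lra. }
rewrite clamp_id by lra.
replace (f y + f' y * (y - y) - (f x + f' x * (x - x))) with (f y - f x) by ring.
apply Hd; unfold space; lra.
Qed.

Lemma continuity_2d_clamp (a S T : R) (g : R -> R -> R) (x t : R) :
  0 <= a -> 0 <= S < T -> continuous_on_cylinder a T g ->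
  continuity_2d_pt (fun y s => g (clamp 0 a y) (clamp 0 S s)) x t.
Proof.
intros a0 [S0 ST] H.
generalize (clamp_bounds 0 a x a0) (clamp_bounds 0 S t S0); intros bx bt.
assert (dx : space a (clamp 0 a x)) by exact bx.
assert (dt : time T (clamp 0 S t)) by (unfold time; lra).
generalize (proj1 (filterlim_locally _ _) (H _ _ dx dt)); intros K eps.
destruct (K eps) as [d Hd].
exists d; intros y s yx st.
generalize (clamp_bounds 0 a y a0) (clamp_bounds 0 S s S0); intros by_ bs.
refine (Hd (clamp 0 a y, clamp 0 S s) _ _).
- split; simpl.
  + apply Rle_lt_trans with (2 := yx); apply clamp_dist.
  + apply Rle_lt_trans with (2 := st); apply clamp_dist.
- unfold space, time; simpl; lra.
Qed.

Lemma is_derive_Rpower (r x : R) :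
  0 < x -> is_derive (fun y => Rpower y r) x (r * Rpower x (r - 1)).
Proof. intros; apply is_derive_Reals, derivable_pt_lim_power; assumption. Qed.

Lemma mean_value (f df : R -> R) (lo hi : R) :
  lo < hi -> (forall x, lo < x < hi -> is_derive f x (df x)) ->
  (forall x, lo <= x <= hi -> continuity_pt f x) ->
  exists c, lo < c < hi /\ f hi - f lo = df c * (hi - lo).
Proof.
intros lh Hd Hc.
assert (pr : forall c, lo < c < hi -> derivable_pt f c).
{ intros c Hc'; exists (df c); apply is_derive_Reals, Hd, Hc'. }
destruct (MVT f id lo hi pr (fun c _ => derivable_pt_id c) lh Hc) as [c [P E]].
{ intros; apply derivable_continuous, derivable_id. }
exists c; split; [exact P |].
replace (derive_pt f c (pr c P)) with (df c) in E.
- rewrite derive_pt_id in E; unfold id in E; lra.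
- symmetry; apply derive_pt_eq_0, is_derive_Reals, Hd, P.
Qed.

Lemma is_derive_eq (f : R -> R) (x l l' : R) : is_derive f x l -> l = l' -> is_derive f x l'.
Proof. intros H E; rewrite <- E; exact H. Qed.

Lemma is_derive_Rmult (f g : R -> R) (x df dg : R) :
  is_derive f x df -> is_derive g x dg ->
  is_derive (fun y => f y * g y) x (df * g x + f x * dg).
Proof. intros; apply (is_derive_mult f g); [assumption.. | intros; apply Rmult_comm]. Qed.

Lemma is_derive_Rplus (f g : R -> R) (x df dg : R) :
  is_derive f x df -> is_derive g x dg -> is_derive (fun y => f y + g y) x (df + dg).
Proof. exact (is_derive_plus f g x df dg). Qed.

Lemma is_derive_Rminus (f g : R -> R) (x df dg : R) :
  is_derive f x df -> is_derive g x dg -> is_derive (fun y => f y - g y) x (df - dg).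
Proof. exact (is_derive_minus f g x df dg). Qed.

Lemma is_derive_continuity_pt (f : R -> R) (x l : R) : is_derive f x l -> continuity_pt f x.
Proof.
intros H; apply continuity_pt_filterlim.
apply @ex_derive_continuous; exists l; exact H.
Qed.

Lemma is_derive_right_nonpos (f : R -> R) (x r l : R) :
  is_derive f x l -> 0 < r -> (forall y, x < y < x + r -> f y <= f x) -> l <= 0.
Proof.
intros H r0 M; apply Rnot_lt_le; intros l0.
apply is_derive_Reals in H.
destruct (H l l0) as [d Hd].
set (h := Rmin d r / 2).
assert (0 < h < d /\ h < r) as [? ?].
{ unfold h; generalize (cond_pos d); intros; unfold Rmin; destruct (Rle_dec _ _); lra. }
assert (A : Rabs ((f (x + h) - f x) / h - l) < l).
{ apply Hd; [lra | rewrite Rabs_pos_eq; lra]. }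
apply Rabs_def2 in A.
assert (B : 0 < (f (x + h) - f x) / h) by lra.
assert (0 < (f (x + h) - f x) / h * h) by (apply Rmult_lt_0_compat; lra).
replace ((f (x + h) - f x) / h * h) with (f (x + h) - f x) in * by (field; lra).
assert (f (x + h) <= f x) by (apply M; lra); lra.
Qed.

Lemma is_derive_left_nonneg (f : R -> R) (x r l : R) :
  is_derive f x l -> 0 < r -> (forall y, x - r < y < x -> f y <= f x) -> 0 <= l.
Proof.
intros H r0 M.
assert (K : - l <= 0); [| lra].
apply is_derive_right_nonpos with (f := fun y => f (- y)) (x := - x) (r := r).
- replace (- l) with (-1 * l) by ring.
  apply (is_derive_comp f Ropp); [rewrite Ropp_involutive; exact H |].
  auto_derive; [trivial | ring].
- exact r0.
- intros y Hy; rewrite Ropp_involutive; apply M; lra.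
Qed.

Lemma second_derivative_nonpos (f f1 : R -> R) (x r l : R) :
  0 < r -> (forall y, x - r < y < x + r -> is_derive f y (f1 y)) ->
  is_derive f1 x l -> f1 x = 0 -> (forall y, x - r < y < x + r -> f y <= f x) -> l <= 0.
Proof.
intros r0 D1 D2 E M; apply Rnot_lt_le; intros l0.
apply is_derive_Reals in D2.
destruct (D2 l l0) as [d Hd].
set (h := Rmin d r / 2).
assert (0 < h < d /\ h < r) as [? ?].
{ unfold h; generalize (cond_pos d); intros; unfold Rmin; destruct (Rle_dec _ _); lra. }
destruct (mean_value f f1 x (x + h)) as [c [Hc Ec]].
- lra.
- intros; apply D1; lra.
- intros; apply is_derive_continuity_pt with (f1 x0), D1; lra.
- assert (A : Rabs ((f1 (x + (c - x)) - f1 x) / (c - x) - l) < l).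
  { apply Hd; [lra | rewrite Rabs_pos_eq; lra]. }
  apply Rabs_def2 in A; replace (x + (c - x)) with c in A by ring; rewrite E in A.
  assert (0 < (f1 c - 0) / (c - x) * (c - x)) by (apply Rmult_lt_0_compat; lra).
  replace ((f1 c - 0) / (c - x) * (c - x)) with (f1 c) in * by (field; lra).
  assert (0 < f1 c * h) by (apply Rmult_lt_0_compat; lra).
  assert (f (x + h) <= f x) by (apply M; lra).
  replace (x + h - x) with h in Ec by ring; lra.
Qed.

Lemma continuity_2d_pt_fix_r (f : R -> R -> R) (x y : R) :
  continuity_2d_pt f x y -> continuity_pt (fun s => f s y) x.
Proof.
intros H; apply continuity_pt_filterlim, filterlim_locally; intros eps.
destruct (H eps) as [d Hd]; exists d; intros s Hs.
apply (Hd s y Hs); rewrite Rminus_diag, Rabs_R0; apply cond_pos.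
Qed.

Lemma continuity_2d_pt_fix_l (f : R -> R -> R) (x y : R) :
  continuity_2d_pt f x y -> continuity_pt (fun s => f x s) y.
Proof.
intros H; apply continuity_pt_filterlim, filterlim_locally; intros eps.
destruct (H eps) as [d Hd]; exists d; intros s Hs.
apply (Hd x s); [rewrite Rminus_diag, Rabs_R0; apply cond_pos | exact Hs].
Qed.

Lemma continuity_2d_pt_shift (f : R -> R -> R) (h k x y : R) :
  continuity_2d_pt f (x + h) (y + k) -> continuity_2d_pt (fun u v => f (u + h) (v + k)) x y.
Proof.
intros H eps; destruct (H eps) as [d Hd]; exists d; intros u v Hu Hv.
apply Hd; [replace (u + h - (x + h)) with (u - x) by ring |
           replace (v + k - (y + k)) with (v - y) by ring]; assumption.
Qed.

(** * Maximum principles *)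

Lemma maximum_rectangle (f : R -> R -> R) (a b c d : R) :
  a <= b -> c <= d ->
  (forall x y, a <= x <= b -> c <= y <= d -> continuity_2d_pt f x y) ->
  exists x0 y0, a <= x0 <= b /\ c <= y0 <= d /\
    forall x y, a <= x <= b -> c <= y <= d -> f x y <= f x0 y0.
Proof.
intros ab cd Hc.
assert (HX : forall y, exists x0, a <= x0 <= b /\
          forall x, a <= x <= b -> f x (clamp c d y) <= f x0 (clamp c d y)).
{ intros y; generalize (clamp_bounds c d y cd); intros by_.
  destruct (continuity_ab_maj (fun x => f x (clamp c d y)) a b ab) as [x0 [H1 H2]].
  - intros x Hx; apply (continuity_2d_pt_fix_r f), Hc; assumption.
  - exists x0; split; assumption. }
set (X y := proj1_sig (constructive_indefinite_description _ (HX y))).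
assert (XP : forall y, a <= X y <= b /\
          forall x, a <= x <= b -> f x (clamp c d y) <= f (X y) (clamp c d y)).
{ intros y; unfold X; destruct (constructive_indefinite_description _ _); assumption. }
destruct (continuity_ab_maj (fun y => f (X y) (clamp c d y)) c d cd) as [y0 [H1 H2]].
- intros y _; apply continuity_pt_filterlim, filterlim_locally; intros eps.
  destruct (uniform_continuity_2d f a b c d Hc eps) as [r Hr].
  exists r; intros z Hz.
  generalize (XP y) (XP z); intros [Xy My] [Xz Mz].
  generalize (clamp_bounds c d y cd) (clamp_bounds c d z cd); intros by_ bz.
  generalize (My _ Xz) (Mz _ Xy); intros.
  assert (K : forall x, a <= x <= b -> Rabs (f x (clamp c d z) - f x (clamp c d y)) < eps).
  { intros x Hx; apply Hr; try assumption.
    - rewrite Rminus_diag, Rabs_R0; apply cond_pos.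
    - apply Rle_lt_trans with (2 := Hz), clamp_dist. }
  generalize (K _ Xy) (K _ Xz); intros K1 K2.
  apply Rabs_def2 in K1; apply Rabs_def2 in K2.
  apply Rabs_def1; unfold minus, plus, opp; simpl; lra.
- exists (X y0), y0; split; [apply XP | split; [exact H2 |]].
  intros x y Hx Hy.
  generalize (H1 y Hy); rewrite !clamp_id by assumption; intros A.
  apply Rle_trans with (2 := A).
  generalize (proj2 (XP y) x Hx); rewrite clamp_id by assumption; trivial.
Qed.

Lemma strict_maximum_principle (b t0 S : R) (z zx zxx zt : R -> R -> R) :
  0 < b ->
  (forall x t, 0 <= x <= b -> t0 <= t <= S -> continuity_2d_pt z x t) ->
  (forall x t, 0 <= x <= b -> t0 < t <= S -> is_derive (fun y => z y t) x (zx x t)) ->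
  (forall x t, 0 < x < b -> t0 < t <= S -> is_derive (fun y => zx y t) x (zxx x t)) ->
  (forall x t, 0 < x < b -> t0 < t <= S -> is_derive (fun s => z x s) t (zt x t)) ->
  (forall x t, 0 < x < b -> t0 < t <= S -> 0 < z x t -> zx x t = 0 -> zt x t < zxx x t) ->
  (forall t, t0 < t <= S -> 0 < z 0 t -> 0 < zx 0 t) ->
  (forall t, t0 < t <= S -> 0 < z b t -> zx b t < 0) ->
  (forall x, 0 <= x <= b -> z x t0 <= 0) ->
  forall x t, 0 <= x <= b -> t0 <= t <= S -> z x t <= 0.
Proof.
intros b0 Hc Hx Hxx Ht Hi Hl Hr H0 x t bx bt.
destruct (maximum_rectangle z 0 b t0 S) as [x1 [t1 [bx1 [bt1 M]]]]; [lra | lra | exact Hc |].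
apply Rle_trans with (1 := M x t bx bt).
apply Rnot_lt_le; intros P.
assert (t01 : t0 < t1).
{ destruct (Rle_lt_or_eq_dec t0 t1) as [L | E]; [lra | exact L |].
  subst t1; generalize (H0 x1 bx1); lra. }
assert (Dx := Hx x1 t1 bx1 (conj t01 (proj2 bt1))).
destruct (Rle_lt_or_eq_dec 0 x1) as [x0 | E]; [lra | |].
2:{ subst x1; generalize (Hl t1 (conj t01 (proj2 bt1)) P).
    assert (zx 0 t1 <= 0); [| lra].
    apply is_derive_right_nonpos with (1 := Dx) (r := b); [lra |].
    intros; apply M; lra. }
destruct (Rle_lt_or_eq_dec x1 b) as [xb | E]; [lra | |].
2:{ subst x1; generalize (Hr t1 (conj t01 (proj2 bt1)) P).
    assert (0 <= zx b t1); [| lra].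
    apply is_derive_left_nonneg with (1 := Dx) (r := b); [lra |].
    intros; apply M; lra. }
assert (E : zx x1 t1 = 0).
{ apply Rle_antisym.
  - apply is_derive_right_nonpos with (1 := Dx) (r := b - x1); [lra |].
    intros; apply M; lra.
  - apply is_derive_left_nonneg with (1 := Dx) (r := x1); [lra |].
    intros; apply M; lra. }
assert (I : 0 < x1 < b) by lra.
assert (J : t0 < t1 <= S) by lra.
generalize (Hi x1 t1 I J P E).
assert (0 <= zt x1 t1).
{ apply is_derive_left_nonneg with (1 := Ht x1 t1 I J) (r := t1 - t0); [lra |].
  intros; apply M; lra. }
assert (zxx x1 t1 <= 0); [| lra].
apply second_derivative_nonpos with (f := fun y => z y t1) (f1 := fun y => zx y t1)
  (x := x1) (r := Rmin x1 (b - x1)).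
- apply Rmin_pos; lra.
- intros y Hy; apply Hx; [| lra].
  generalize (Rmin_l x1 (b - x1)) (Rmin_r x1 (b - x1)); lra.
- apply Hxx; assumption.
- exact E.
- intros y Hy; apply M; [| lra].
  generalize (Rmin_l x1 (b - x1)) (Rmin_r x1 (b - x1)); lra.
Qed.

Lemma neumann_maximum_principle (b t0 S M eta : R) (w wx wxx wt : R -> R -> R) :
  0 < b -> 0 < eta ->
  (forall x t, 0 <= x <= b -> t0 <= t <= S -> continuity_2d_pt w x t) ->
  (forall x t, 0 <= x <= b -> t0 < t <= S -> is_derive (fun y => w y t) x (wx x t)) ->
  (forall x t, 0 < x < b -> t0 < t <= S -> is_derive (fun y => wx y t) x (wxx x t)) ->
  (forall x t, 0 < x < b -> t0 < t <= S -> is_derive (fun s => w x s) t (wt x t)) ->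
  (forall x t, 0 < x < b -> t0 < t <= S -> wt x t <= wxx x t) ->
  (forall t, t0 < t <= S -> - eta <= wx 0 t) ->
  (forall t, t0 < t <= S -> wx b t <= eta) ->
  (forall x, 0 <= x <= b -> w x t0 <= M) ->
  forall x t, 0 <= x <= b -> t0 <= t <= S -> w x t <= M + 2 * eta * (b ^ 2 + 3 * (t - t0)) / b.
Proof.
intros b0 e0 Hc Hx Hxx Ht Hi Hl Hr H0 x t bx bt.
set (psi := fun x t => M + 2 * eta * ((x - b / 2) ^ 2 + 3 * (t - t0)) / b).
apply Rle_trans with (psi x t).
2:{ unfold psi, Rdiv; apply Rplus_le_compat_l, Rmult_le_compat_r.
    - left; apply Rinv_0_lt_compat, b0.
    - apply Rmult_le_compat_l; [lra |]. assert ((x - b * / 2) ^ 2 <= b ^ 2) by nra; lra. }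
apply Rminus_le.
apply (strict_maximum_principle b t0 S (fun x t => w x t - psi x t)
  (fun x t => wx x t - 4 * eta * (x - b / 2) / b) (fun x t => wxx x t - 4 * eta / b)
  (fun x t => wt x t - 6 * eta / b)); try assumption; unfold psi; clear psi.
- intros y s Hy Hs; apply continuity_2d_pt_minus; [apply Hc; assumption |].
  apply continuity_2d_pt_ext with (fun u v =>
    (fun u => M + 2 * eta * (u - b / 2) ^ 2 / b) u + (fun v => 2 * eta * 3 * (v - t0) / b) v).
  + intros; simpl; field; lra.
  + apply continuity_2d_pt_plus.
    * apply (continuity_1d_2d_pt_comp (fun u => M + 2 * eta * (u - b / 2) ^ 2 / b) (fun u _ => u));
        [| apply continuity_2d_pt_id1].
      eapply is_derive_continuity_pt; auto_derive; trivial.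
    * apply (continuity_1d_2d_pt_comp (fun v => 2 * eta * 3 * (v - t0) / b) (fun _ v => v));
        [| apply continuity_2d_pt_id2].
      eapply is_derive_continuity_pt; auto_derive; trivial.
- intros y s Hy Hs; apply is_derive_Rminus; [apply Hx; assumption |].
  auto_derive; [trivial | field; lra].
- intros y s Hy Hs; apply is_derive_Rminus; [apply Hxx; assumption |].
  auto_derive; [trivial | field; lra].
- intros y s Hy Hs; apply is_derive_Rminus; [apply Ht; assumption |].
  auto_derive; [trivial | field; lra].
- intros y s Hy Hs _ _; generalize (Hi y s Hy Hs).
  assert (0 < eta / b) by (apply Rdiv_lt_0_compat; assumption).
  unfold Rdiv in *; lra.
- intros s Hs _; generalize (Hl s Hs).
  replace (4 * eta * (0 - b / 2) / b) with (- (2 * eta)) by (field; lra); lra.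
- intros s Hs _; generalize (Hr s Hs).
  replace (4 * eta * (b - b / 2) / b) with (2 * eta) by (field; lra); lra.
- intros y Hy; generalize (H0 y Hy).
  assert (0 <= 2 * eta * ((y - b / 2) ^ 2 + 3 * (t0 - t0)) / b); [| lra].
  apply Rmult_le_pos; [| left; apply Rinv_0_lt_compat, b0].
  apply Rmult_le_pos; [lra |]; generalize (pow2_ge_0 (y - b / 2)); lra.
Qed.

Lemma robin_maximum_principle (a S B : R) (w wx wxx wt : R -> R -> R) :
  0 < a -> 0 <= B ->
  (forall x t, 0 <= x <= a -> 0 <= t <= S -> continuity_2d_pt w x t) ->
  (forall x t, 0 <= x <= a -> 0 < t <= S -> is_derive (fun y => w y t) x (wx x t)) ->
  (forall x t, 0 < x < a -> 0 < t <= S -> is_derive (fun y => wx y t) x (wxx x t)) ->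
  (forall x t, 0 < x < a -> 0 < t <= S -> is_derive (fun s => w x s) t (wt x t)) ->
  (forall x t, 0 < x < a -> 0 < t <= S -> wt x t <= wxx x t) ->
  (forall t, 0 < t <= S -> 0 < w 0 t -> - B * w 0 t <= wx 0 t) ->
  (forall t, 0 < t <= S -> 0 < w a t -> wx a t <= B * w a t) ->
  (forall x, 0 <= x <= a -> w x 0 <= 0) ->
  forall x t, 0 <= x <= a -> 0 <= t <= S -> w x t <= 0.
Proof.
intros a0 B0 Hc Hx Hxx Ht Hi Hl Hr H0 x t bx bt.
set (la := (B + 1) / a).
assert (laa : la * a = B + 1) by (unfold la; field; lra).
assert (la0 : 0 < la) by (apply Rdiv_lt_0_compat; lra).
set (K := (B + 1) ^ 2 + 2 * la + 1).
(* [E] turns the Robin condition into a strict Neumann one: its logarithmic [x]-derivative is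
   [la * a > B] at [0] and [- la * a] at [a]. *)
set (E := fun x t => exp (- K * t - la * (x - a / 2) ^ 2)).
assert (E0 : forall x t, 0 < E x t) by (intros; apply exp_pos).
set (g := fun x => - 2 * la * (x - a / 2)).
assert (Ex : forall x t, is_derive (fun y => E y t) x (g x * E x t)).
{ intros; unfold E, g; auto_derive; [trivial | ]. unfold Rminus; simpl; ring. }
assert (Et : forall x t, is_derive (fun s => E x s) t (- K * E x t)).
{ intros; unfold E; auto_derive; [trivial | ]. unfold Rminus; simpl; ring. }
assert (Ec : forall x t, continuity_2d_pt E x t).
{ intros y s.
  apply (continuity_1d_2d_pt_comp exp (fun y s => - K * s - la * (y - a / 2) ^ 2)).
  - apply derivable_continuous, derivable_exp.
  - apply continuity_2d_pt_minus.
    + apply (continuity_1d_2d_pt_comp (fun v => - K * v) (fun _ v => v));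
        [| apply continuity_2d_pt_id2].
      eapply is_derive_continuity_pt; auto_derive; trivial.
    + apply (continuity_1d_2d_pt_comp (fun u => la * (u - a / 2) ^ 2) (fun u _ => u));
        [| apply continuity_2d_pt_id1].
      eapply is_derive_continuity_pt; auto_derive; trivial. }
assert (Q : forall eps, 0 < eps -> w x t * E x t - eps <= 0).
{ intros eps e0.
  assert (pos : forall y s, 0 < w y s * E y s - eps -> 0 < w y s).
  { intros y s P; apply Rnot_le_lt; intros N; generalize (E0 y s); intros.
    assert (w y s * E y s <= 0) by nra; lra. }
  apply (strict_maximum_principle a 0 S (fun x t => w x t * E x t - eps)
    (fun x t => (wx x t + g x * w x t) * E x t)
    (fun x t => (wxx x t + 2 * g x * wx x t + (g x ^ 2 - 2 * la) * w x t) * E x t)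
    (fun x t => (wt x t - K * w x t) * E x t)); try assumption.
  - intros y s Hy Hs; apply continuity_2d_pt_minus; [| apply continuity_2d_pt_const].
    apply continuity_2d_pt_mult; [apply Hc; assumption | apply Ec].
  - intros y s Hy Hs; eapply is_derive_eq.
    { apply is_derive_Rminus; [apply is_derive_Rmult; [apply Hx; assumption | apply Ex] |].
      apply @is_derive_const. }
    unfold zero; simpl; ring.
  - intros y s Hy Hs.
    assert (G : is_derive g y (- 2 * la)).
    { unfold g; auto_derive; [trivial | ring]. }
    eapply is_derive_eq.
    { apply is_derive_Rmult; [| apply Ex].
      apply is_derive_Rplus; [apply Hxx; assumption |].
      apply is_derive_Rmult; [exact G | apply Hx; lra]. }
    simpl; ring.
  - intros y s Hy Hs; eapply is_derive_eq.
    { apply is_derive_Rminus; [apply is_derive_Rmult; [apply Ht; assumption | apply Et] |].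
      apply @is_derive_const. }
    unfold zero; simpl; ring.
  - intros y s Hy Hs P Z; apply pos in P.
    apply Rmult_lt_compat_r; [apply E0 |].
    generalize (Hi y s Hy Hs); intros I.
    assert (Z' : wx y s = - g y * w y s).
    { apply Rmult_integral in Z; generalize (E0 y s); intros; lra. }
    rewrite Z'.
    assert (G2 : g y ^ 2 <= (B + 1) ^ 2).
    { rewrite <- laa; unfold g.
      replace ((-2 * la * (y - a / 2)) ^ 2) with (la ^ 2 * (4 * (y - a / 2) ^ 2)) by ring.
      replace ((la * a) ^ 2) with (la ^ 2 * a ^ 2) by ring.
      apply Rmult_le_compat_l; [apply pow2_ge_0 | nra]. }
    assert (0 < (K - g y ^ 2 - 2 * la) * w y s).
    { apply Rmult_lt_0_compat; [unfold K; lra | exact P]. }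
    nra.
  - intros s Hs P; apply pos in P.
    apply Rmult_lt_0_compat; [| apply E0].
    generalize (Hl s Hs P); unfold g.
    replace (-2 * la * (0 - a / 2)) with (la * a) by field; rewrite laa; lra.
  - intros s Hs P; apply pos in P.
    generalize (Hr s Hs P) (E0 a s); unfold g; intros R1 R2.
    replace (-2 * la * (a - a / 2)) with (- (la * a)) by field; rewrite laa.
    assert (wx a s + - (B + 1) * w a s < 0) by lra; nra.
  - intros y Hy; generalize (H0 y Hy) (E0 y 0); intros; nra. }
apply Rnot_lt_le; intros P.
generalize (Q (w x t * E x t / 2)) (Rmult_lt_0_compat _ _ P (E0 x t)); lra.
Qed.

(** * Monotonicity in time and the quenching rate *)

Lemma Rpower_pos (x r : R) : 0 < Rpower x r.
Proof. apply exp_pos. Qed.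

Lemma Rpower_neg_decreasing (r x y : R) :
  0 <= r -> 0 < x <= y -> Rpower y (- r) <= Rpower x (- r).
Proof.
intros r0 [x0 xy]; rewrite !Rpower_Ropp.
apply Rinv_le_contravar; [apply Rpower_pos | apply Rle_Rpower_l; lra].
Qed.

Lemma is_derive_Rpower_comp (f : R -> R) (x df r : R) :
  0 < f x -> is_derive f x df ->
  is_derive (fun y => Rpower (f y) r) x (r * Rpower (f x) (r - 1) * df).
Proof.
intros P H; eapply is_derive_eq.
- apply (is_derive_comp (fun z => Rpower z r) f); [apply is_derive_Rpower, P | exact H].
- unfold scal; simpl; unfold mult; simpl; ring.
Qed.

Lemma Rpower_neg_lipschitz (r m : R) :
  0 < r -> 0 < m -> exists B, 0 <= B /\
    forall y z, m <= z <= y -> Rpower z (- r) - Rpower y (- r) <= B * (y - z).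
Proof.
intros r0 m0; exists (r * Rpower m (- (r + 1))); split.
- apply Rmult_le_pos; [lra | left; apply Rpower_pos].
- intros y z [mz zy].
  destruct (Rle_lt_or_eq_dec z y zy) as [L | E]; [| subst z; lra].
  assert (Hd : forall x, z <= x <= y ->
    is_derive (fun s => Rpower s (- r)) x (- r * Rpower x (- r - 1))).
  { intros; apply is_derive_Rpower; lra. }
  destruct (mean_value (fun s => Rpower s (- r)) (fun x => - r * Rpower x (- r - 1)) z y L)
    as [c [Hc Ec]].
  + intros; apply Hd; lra.
  + intros x Hx; eapply is_derive_continuity_pt, Hd, Hx.
  + replace (- r - 1) with (- (r + 1)) in Ec by ring.
    generalize (Rpower_neg_decreasing (r + 1) m c); intros A.
    assert (0 <= r * (Rpower m (- (r + 1)) - Rpower c (- (r + 1))) * (y - z)); [| lra].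
    apply Rmult_le_pos; [apply Rmult_le_pos |]; lra.
Qed.

(* The heat equation is [flow_dxx]: [vt] is also the derivative of [vx].  [flow_dx] holds for all
   [x] because [v] will be the continuation of the solution by its tangents at [0] and [a]. *)
Record heat_flow (a p q S : R) (v vx vt : R -> R -> R) : Prop := {
  flow_continuous : forall x t, continuity_2d_pt v x t;
  flow_continuous_x : forall x t, continuity_2d_pt vx x t;
  flow_continuous_t : forall x t, continuity_2d_pt vt x t;
  flow_dx : forall x t, is_derive (fun y => v y t) x (vx x t);
  flow_dxx : forall x t, 0 < x < a -> 0 < t < S -> is_derive (fun y => vx y t) x (vt x t);
  flow_dt : forall x t, 0 <= x <= a -> 0 < t < S -> is_derive (fun s => v x s) t (vt x t);
  flow_left : forall t, 0 <= t < S -> vx 0 t = Rpower (v 0 t) (- p);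
  flow_right : forall t, 0 <= t < S -> vx a t = Rpower (1 - v a t) (- q);
  flow_pos : forall t, 0 <= t <= S -> 0 < v 0 t;
  flow_lt1 : forall t, 0 <= t <= S -> v a t < 1 }.

Lemma is_derive_shift (f : R -> R) (x h l : R) :
  is_derive f (x + h) l -> is_derive (fun y => f (y + h)) x l.
Proof.
intros H; eapply is_derive_eq.
- apply (is_derive_comp f (fun y => y + h)); [exact H |].
  auto_derive; [trivial | reflexivity].
- unfold scal; simpl; unfold mult; simpl; ring.
Qed.

Lemma flow_decreasing (a p q S : R) (v vx vt : R -> R -> R) (x t s : R) :
  0 < a -> 0 < p -> 0 < q -> heat_flow a p q S v vx vt ->
  (forall x, 0 < x < a -> exists l, is_derive (fun y => vx y 0) x l /\ l <= 0) ->
  0 <= x <= a -> 0 <= t <= s -> s < S -> v x s <= v x t.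
Proof.
intros a0 p0 q0 [Fc Fcx Fct Fx Fxx Ft Fl Fr Fp F1] Hconc Hx Hts HsS.
assert (S0 : 0 <= S) by lra.
destruct (continuity_ab_min (fun t => v 0 t) 0 S S0) as [t1 [M1 B1]].
{ intros c _; apply (continuity_2d_pt_fix_l v), Fc. }
destruct (continuity_ab_maj (fun t => v a t) 0 S S0) as [t2 [M2 B2]].
{ intros c _; apply (continuity_2d_pt_fix_l v), Fc. }
destruct (Rpower_neg_lipschitz p (v 0 t1) p0 (Fp _ B1)) as [Bp [Bp0 Lp]].
destruct (Rpower_neg_lipschitz q (1 - v a t2) q0) as [Bq [Bq0 Lq]].
{ generalize (F1 _ B2); lra. }
set (B := Rmax Bp Bq).
assert (BP : Bp <= B) by apply Rmax_l.
assert (BQ : Bq <= B) by apply Rmax_r.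
assert (left : forall r r', 0 <= r < S -> 0 <= r' < S -> 0 < v 0 r - v 0 r' ->
          - B * (v 0 r - v 0 r') <= vx 0 r - vx 0 r').
{ intros r r' Hr Hr' P; rewrite !Fl by assumption.
  assert (v 0 t1 <= v 0 r') by (apply M1; lra).
  generalize (Lp (v 0 r) (v 0 r')); intros A.
  assert (Bp * (v 0 r - v 0 r') <= B * (v 0 r - v 0 r')) by (apply Rmult_le_compat_r; lra).
  lra. }
assert (right : forall r r', 0 <= r < S -> 0 <= r' < S -> 0 < v a r - v a r' ->
          vx a r - vx a r' <= B * (v a r - v a r')).
{ intros r r' Hr Hr' P; rewrite !Fr by assumption.
  assert (v a r <= v a t2) by (apply M2; lra).
  generalize (Lq (1 - v a r') (1 - v a r)); intros A.
  assert (Bq * (v a r - v a r') <= B * (v a r - v a r')) by (apply Rmult_le_compat_r; lra).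
  lra. }
assert (init : forall y r, 0 <= y <= a -> 0 <= r < S -> v y r - v y 0 <= 0).
{ intros y r Hy Hr.
  apply (robin_maximum_principle a r B (fun x t => v x t - v x 0) (fun x t => vx x t - vx x 0)
    (fun x t => vt x t - Derive (fun y => vx y 0) x) vt); try assumption; try lra.
  - intros x' t' _ _; apply continuity_2d_pt_minus; [apply Fc |].
    apply (continuity_1d_2d_pt_comp (fun u => v u 0) (fun u _ => u));
      [| apply continuity_2d_pt_id1].
    apply (continuity_2d_pt_fix_r v), Fc.
  - intros; apply is_derive_Rminus; apply Fx.
  - intros x' t' Hx' Ht'; apply is_derive_Rminus; [apply Fxx; lra |].
    destruct (Hconc x' Hx') as [l [Hl _]]; apply Derive_correct; exists l; exact Hl.
  - intros x' t' Hx' Ht'; eapply is_derive_eq.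
    + apply is_derive_Rminus; [apply Ft; lra | apply @is_derive_const].
    + unfold zero; simpl; ring.
  - intros x' t' Hx' Ht'; destruct (Hconc x' Hx') as [l [Hl l0]].
    assert (D : Derive (fun y => vx y 0) x' = l) by (apply is_derive_unique, Hl).
    cbv beta; lra.
  - intros; apply left; lra.
  - intros; apply right; lra.
  - intros; lra. }
set (h := s - t).
assert (K : v x (t + h) - v x t <= 0).
{ apply (robin_maximum_principle a t B (fun x t => v x (t + h) - v x t)
    (fun x t => vx x (t + h) - vx x t) (fun x t => vt x (t + h) - vt x t)
    (fun x t => vt x (t + h) - vt x t)); try assumption; try lra; unfold h; clear h.
  - intros x' t' _ _; apply continuity_2d_pt_minus; [| apply Fc].
    apply continuity_2d_pt_ext with (fun y r => v (y + 0) (r + (s - t))).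
    { intros; rewrite Rplus_0_r; reflexivity. }
    apply continuity_2d_pt_shift, Fc.
  - intros; apply is_derive_Rminus; apply Fx.
  - intros x' t' Hx' Ht'; apply is_derive_Rminus; apply Fxx; lra.
  - intros x' t' Hx' Ht'; apply is_derive_Rminus; [apply (is_derive_shift (v x')) |]; apply Ft; lra.
  - intros; lra.
  - intros; apply left; lra.
  - intros; apply right; lra.
  - intros y Hy; rewrite Rplus_0_l; apply init; lra. }
unfold h in K; replace (t + (s - t)) with s in K by ring; lra.
Qed.

Lemma difference_quotient_limit (f : R -> R) (x l eps : R) :
  is_derive f x l -> 0 < eps ->
  exists d, 0 < d /\ forall h, 0 < h < d -> Rabs ((f (x + h) - f x) / h - l) < eps.
Proof.
intros H e0; apply is_derive_Reals in H; destruct (H eps e0) as [d Hd].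
exists d; split; [apply cond_pos |]; intros h Hh.
apply Hd; [lra | rewrite Rabs_pos_eq; lra].
Qed.

Lemma flow_flux_nonincreasing (a p q S : R) (v vx vt : R -> R -> R) (x y t : R) :
  heat_flow a p q S v vx vt ->
  (forall x t, 0 <= x <= a -> 0 < t < S -> vt x t <= 0) ->
  0 < t < S -> 0 <= x <= y -> y <= a -> vx y t <= vx x t.
Proof.
intros [Fc Fcx Fct Fx Fxx Ft Fl Fr Fp F1] N Ht Hxy ya.
destruct (Rle_lt_or_eq_dec x y (proj2 Hxy)) as [L | E]; [| subst y; lra].
destruct (mean_value (fun y => vx y t) (fun y => vt y t) x y L) as [c [Hc Ec]].
- intros; apply Fxx; lra.
- intros z _; apply (continuity_2d_pt_fix_r vx), Fcx.
- assert (vt c t <= 0) by (apply N; lra); nra.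
Qed.

Lemma flow_quench_rate (a p q S : R) (v vx vt : R -> R -> R) (tau t : R) :
  0 < a -> 0 < p -> 0 < q -> heat_flow a p q S v vx vt ->
  (forall x t s, 0 <= x <= a -> 0 < t <= s -> s < S -> v x s <= v x t) ->
  0 < tau <= t -> t < S ->
  vt 0 t <= p ^ 2 / (2 * p + 1) *
            (Rpower (v 0 tau) (- (2 * p + 1)) - Rpower (v 0 t) (- (2 * p + 1))).
Proof.
intros a0 p0 q0 F Hdec Htau HtS.
assert (N : forall x t, 0 <= x <= a -> 0 < t < S -> vt x t <= 0).
{ intros x s Hx Hs.
  apply is_derive_right_nonpos with (f := fun s => v x s) (x := s) (r := S - s);
    [apply F; lra | lra |].
  intros y Hy; apply Hdec; lra. }
assert (Mx : forall x y t, 0 < t < S -> 0 <= x <= y -> y <= a -> vx y t <= vx x t).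
{ intros; apply flow_flux_nonincreasing with a p q S v vt; assumption. }
destruct F as [Fc Fcx Fct Fx Fxx Ft Fl Fr Fp F1].
set (kap := 2 + / p); set (c := p ^ 2 / (2 * p + 1)).
assert (ip : 0 < / p) by (apply Rinv_0_lt_compat, p0).
assert (k2 : 2 < kap) by (unfold kap; lra).
assert (c0 : 0 < c) by (apply Rdiv_lt_0_compat; nra).
assert (ck : c * kap = p) by (unfold c, kap; field; lra).
assert (Hflux : forall s, 0 < s < S -> Rpower (vx 0 s) kap = Rpower (v 0 s) (- (2 * p + 1))).
{ intros s Hs; rewrite Fl by lra; rewrite Rpower_mult.
  f_equal; unfold kap; field; lra. }
assert (Hflux1 : forall s, 0 < s < S -> Rpower (vx 0 s) (kap - 1) = Rpower (v 0 s) (- (p + 1))).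
{ intros s Hs; rewrite Fl by lra; rewrite Rpower_mult.
  f_equal; unfold kap; field; lra. }
rewrite <- !Hflux by lra.
apply le_epsilon; intros eps e0.
set (G := p * Rpower (v 0 t) (- (p + 1))).
assert (G0 : 0 < G) by (apply Rmult_lt_0_compat; [exact p0 | apply Rpower_pos]).
set (L := 2 * (a ^ 2 + 3 * (t - tau)) / (a / 2)).
assert (L0 : 0 < L) by (apply Rdiv_lt_0_compat; nra).
set (eta := eps / (3 * L)).
assert (eta0 : 0 < eta) by (apply Rdiv_lt_0_compat; lra).
set (S1 := (t + S) / 2).
assert (HS1 : t < S1 < S) by (unfold S1; lra).
destruct (uniform_continuity_2d vt 0 a tau S1 (fun x y _ _ => Fct x y)
  (mkposreal _ (Rdiv_lt_0_compat _ _ eta0 G0))) as [d1 Hd1]; simpl in Hd1.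
assert (e3 : 0 < eps / 3) by lra.
destruct (difference_quotient_limit (fun s => v 0 s) t (vt 0 t) (eps / 3)) as [d2 [d20 Hd2]];
  [apply Ft; lra | exact e3 |].
set (h := Rmin (Rmin d1 d2) (S1 - t) / 2).
assert (Hh : 0 < h < d1 /\ h < d2 /\ h < S1 - t).
{ unfold h; generalize (cond_pos d1); intros; unfold Rmin; repeat destruct (Rle_dec _ _); lra. }
destruct Hh as [h1 [h2 h3]].
destruct (uniform_continuity_2d vx 0 a tau S1 (fun x y _ _ => Fcx x y)
  (mkposreal _ (Rmult_lt_0_compat _ _ eta0 (proj1 h1)))) as [d3 Hd3]; simpl in Hd3.
assert (vx0 : forall y s, 0 <= y <= a -> 0 < s < S -> 0 < vx y s).
{ intros y s Hy Hs; apply Rlt_le_trans with (vx a s); [| apply Mx; lra].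
  rewrite Fr by lra; apply Rpower_pos. }
assert (Cont : continuity_pt (fun z => c * Rpower z kap) (vx 0 t)).
{ eapply is_derive_continuity_pt, is_derive_Rmult;
    [apply @is_derive_const | apply is_derive_Rpower, vx0; lra]. }
destruct (Cont (eps / 3) e3) as [d4 [d40 Hd4]].
destruct (difference_quotient_limit (fun y => v y t) 0 (vx 0 t) d4) as [d5 [d50 Hd5]];
  [apply Fx | exact d40 |].
set (k := Rmin (Rmin d1 d3) (Rmin d5 a) / 2).
assert (Hk : 0 < k < d1 /\ k < d3 /\ k < d5 /\ k <= a / 2).
{ unfold k; generalize (cond_pos d1) (cond_pos d3); intros.
  unfold Rmin; repeat destruct (Rle_dec _ _); lra. }
destruct Hk as [k1 [k3 [k5 ka]]].
set (W := fun x s => (v x (s + h) - v x s) / h).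
set (Wx := fun x s => (vx x (s + h) - vx x s) / h).
set (Wt := fun x s => (vt x (s + h) - vt x s) / h).
set (D := fun x s => (v (x + k) s - v x s) / k).
set (Dx := fun x s => (vx (x + k) s - vx x s) / k).
set (Dt := fun x s => (vt (x + k) s - vt x s) / k).
assert (Dv : forall x s, 0 <= x <= a - k -> 0 < s < S ->
          exists y, x < y < x + k /\ D x s = vx y s).
{ intros x s Hx Hs.
  destruct (mean_value (fun y => v y s) (fun y => vx y s) x (x + k)) as [y [Hy Ey]]; [lra | | |].
  - intros; apply Fx.
  - intros z _; apply (continuity_2d_pt_fix_r v), Fc.
  - exists y; split; [exact Hy |]; unfold D; rewrite Ey; field; lra. }
assert (D0 : forall x s, 0 <= x <= a - k -> 0 < s < S -> 0 < D x s <= vx 0 s).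
{ intros x s Hx Hs; destruct (Dv x s Hx Hs) as [y [Hy ->]].
  split; [apply vx0 | apply Mx]; lra. }
assert (Dneg : forall x s, 0 <= x <= a - k -> 0 < s < S -> Dx x s <= 0).
{ intros x s Hx Hs; unfold Dx.
  assert (vx (x + k) s <= vx x s) by (apply Mx; lra).
  assert (0 <= (vx x s - vx (x + k) s) / k)
    by (apply Rmult_le_pos; [lra | left; apply Rinv_0_lt_compat; lra]).
  unfold Rdiv in *; lra. }
assert (quot : forall (f g : R -> R) x r df dg, r <> 0 -> is_derive f x df -> is_derive g x dg ->
          is_derive (fun y => (f y - g y) / r) x ((df - dg) / r)).
{ intros f g x r df dg r0 Hf Hg; eapply is_derive_eq.
  - apply is_derive_Rmult; [apply is_derive_Rminus; [exact Hf | exact Hg] | apply @is_derive_const].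
  - unfold zero; simpl; unfold Rdiv; ring. }
assert (Pw : forall f x df r, 0 < f x -> is_derive f x df ->
          is_derive (fun y => c * Rpower (f y) r) x (c * (r * Rpower (f x) (r - 1) * df))).
{ intros f x df r P Hf; eapply is_derive_eq.
  - apply is_derive_Rmult; [apply @is_derive_const | apply is_derive_Rpower_comp; [exact P | exact Hf]].
  - unfold zero; simpl; ring. }
assert (key : W 0 t + c * Rpower (D 0 t) kap <= c * Rpower (vx 0 tau) kap
                + 2 * eta * ((a - k) ^ 2 + 3 * (t - tau)) / (a - k)).
{ apply (neumann_maximum_principle (a - k) tau t (c * Rpower (vx 0 tau) kap) eta
    (fun x s => W x s + c * Rpower (D x s) kap)
    (fun x s => Wx x s + c * (kap * Rpower (D x s) (kap - 1) * Dx x s))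
    (fun x s => Wt x s + c * (kap * ((kap - 1) * Rpower (D x s) (kap - 1 - 1) * Dx x s * Dx x s
                                     + Rpower (D x s) (kap - 1) * Dt x s)))
    (fun x s => Wt x s + c * (kap * Rpower (D x s) (kap - 1) * Dt x s))); try lra.
  - intros x s Hx Hs; apply continuity_2d_pt_plus.
    + unfold W; apply continuity_2d_pt_mult; [| apply continuity_2d_pt_const].
      apply continuity_2d_pt_minus; [| apply Fc].
      apply continuity_2d_pt_ext with (fun y r => v (y + 0) (r + h)).
      { intros; rewrite Rplus_0_r; reflexivity. }
      apply continuity_2d_pt_shift, Fc.
    + apply (continuity_1d_2d_pt_comp (fun z => c * Rpower z kap) D).
      * eapply is_derive_continuity_pt, is_derive_Rmult;
          [apply @is_derive_const | apply is_derive_Rpower, D0; lra].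
      * unfold D; apply continuity_2d_pt_mult; [| apply continuity_2d_pt_const].
        apply continuity_2d_pt_minus; [| apply Fc].
        apply continuity_2d_pt_ext with (fun y r => v (y + k) (r + 0)).
        { intros; rewrite Rplus_0_r; reflexivity. }
        apply continuity_2d_pt_shift, Fc.
  - intros x s Hx Hs; apply is_derive_Rplus.
    + apply (quot (fun y => v y (s + h)) (fun y => v y s)); [lra | apply Fx | apply Fx].
    + apply (Pw (fun y => D y s)); [apply D0; lra |].
      apply (quot (fun y => v (y + k) s) (fun y => v y s));
        [lra | apply (is_derive_shift (fun y => v y s)), Fx | apply Fx].
  - intros x s Hx Hs; apply is_derive_Rplus.
    + apply (quot (fun y => vx y (s + h)) (fun y => vx y s)); [lra | apply Fxx; lra | apply Fxx; lra].
    + assert (HDx : is_derive (fun y => D y s) x (Dx x s)).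
      { apply (quot (fun y => v (y + k) s) (fun y => v y s));
        [lra | apply (is_derive_shift (fun y => v y s)), Fx | apply Fx]. }
      assert (HDt : is_derive (fun y => Dx y s) x (Dt x s)).
      { apply (quot (fun y => vx (y + k) s) (fun y => vx y s));
          [lra | apply (is_derive_shift (fun y => vx y s)), Fxx; lra | apply Fxx; lra]. }
      eapply is_derive_eq.
      * apply is_derive_Rmult; [apply @is_derive_const |].
        apply is_derive_Rmult; [| exact HDt].
        apply is_derive_Rmult; [apply @is_derive_const |].
        apply (is_derive_Rpower_comp (fun y => D y s)); [apply D0; lra | exact HDx].
      * unfold zero; simpl; ring.
  - intros x s Hx Hs; apply is_derive_Rplus.
    + apply (quot (fun s => v x (s + h)) (v x));
        [lra | apply (is_derive_shift (v x)), Ft; lra | apply Ft; lra].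
    + apply (Pw (D x)); [apply D0; lra |].
      apply (quot (v (x + k)) (v x)); [lra | apply Ft; lra | apply Ft; lra].
  - intros x s Hx Hs.
    assert (0 <= c * (kap * ((kap - 1) * Rpower (D x s) (kap - 1 - 1) * Dx x s * Dx x s))); [| lra].
    apply Rmult_le_pos; [lra |]; apply Rmult_le_pos; [lra |].
    rewrite Rmult_assoc; apply Rmult_le_pos; [| apply Rle_0_sqr].
    apply Rmult_le_pos; [lra | left; apply Rpower_pos].
  - intros s Hs.
    (* By [c * kap = p] and [uxx = ut] both terms are multiples of [p * u^(-p-1)], with factors
       [ut] at two nearby points. *)
    assert (HW : exists xi, s < xi < s + h /\
              Wx 0 s = - p * Rpower (v 0 xi) (- p - 1) * vt 0 xi).
    { destruct (mean_value (fun r => Rpower (v 0 r) (- p))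
        (fun r => - p * Rpower (v 0 r) (- p - 1) * vt 0 r) s (s + h)) as [xi [Hxi Exi]].
      - lra.
      - intros r Hr; apply is_derive_Rpower_comp; [apply Fp; lra | apply Ft; lra].
      - intros r Hr; eapply is_derive_continuity_pt, is_derive_Rpower_comp;
          [apply Fp; lra | apply Ft; lra].
      - exists xi; split; [exact Hxi |].
        unfold Wx; rewrite !Fl by lra; rewrite Exi; field; lra. }
    assert (HD : exists y, 0 < y < 0 + k /\ Dx 0 s = vt y s).
    { destruct (mean_value (fun y => vx y s) (fun y => vt y s) 0 (0 + k)) as [y [Hy Ey]]; [lra | | |].
      - intros; apply Fxx; lra.
      - intros z _; apply (continuity_2d_pt_fix_r vx), Fcx.
      - exists y; split; [exact Hy |]; unfold Dx; rewrite Ey; field; lra. }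
    destruct HW as [xi [Hxi ->]]; destruct HD as [y [Hy HD]].
    assert (Hs' : 0 < s < S) by lra.
    set (Q := Rpower (v 0 s) (- (p + 1))).
    assert (Q0 : 0 < Q) by apply Rpower_pos.
    assert (A1 : Q <= Rpower (v 0 xi) (- p - 1)).
    { replace (- p - 1) with (- (p + 1)) by ring.
      apply Rpower_neg_decreasing; [lra | split; [apply Fp; lra | apply Hdec; lra]]. }
    assert (A2 : Rpower (D 0 s) (kap - 1) <= Q).
    { unfold Q; rewrite <- Hflux1 by exact Hs'.
      apply Rle_Rpower_l; [lra | apply D0; lra]. }
    assert (A3 : p * Q <= G).
    { apply Rmult_le_compat_l; [lra |].
      apply Rpower_neg_decreasing; [lra | split; [apply Fp; lra | apply Hdec; lra]]. }
    assert (N1 : vt 0 xi <= 0) by (apply N; lra).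
    assert (N2 : Dx 0 s <= 0) by (apply Dneg; lra).
    assert (B1 : Rabs (vt 0 xi - vt y s) < eta / G).
    { apply Hd1; try lra.
      - rewrite Rabs_left; lra.
      - rewrite Rabs_pos_eq; lra. }
    apply Rabs_def2 in B1.
    replace (c * (kap * Rpower (D 0 s) (kap - 1) * Dx 0 s))
      with (p * Rpower (D 0 s) (kap - 1) * Dx 0 s) by (rewrite <- ck; ring).
    assert (C1 : p * Q * Dx 0 s <= p * Rpower (D 0 s) (kap - 1) * Dx 0 s).
    { assert (0 <= p * (Q - Rpower (D 0 s) (kap - 1)) * - Dx 0 s); [| lra].
      repeat apply Rmult_le_pos; lra. }
    assert (C2 : - (p * Q * vt 0 xi) <= - p * Rpower (v 0 xi) (- p - 1) * vt 0 xi).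
    { assert (0 <= p * (Rpower (v 0 xi) (- p - 1) - Q) * - vt 0 xi); [| lra].
      repeat apply Rmult_le_pos; lra. }
    rewrite HD in C1 |- *.
    assert (C3 : p * Q * (vt 0 xi - vt y s) <= p * Q * (eta / G)).
    { apply Rmult_le_compat_l; [| lra]. apply Rmult_le_pos; lra. }
    assert (C4 : p * Q * (eta / G) <= G * (eta / G)).
    { apply Rmult_le_compat_r; [| exact A3]. left; apply Rdiv_lt_0_compat; assumption. }
    replace (G * (eta / G)) with eta in C4 by (field; lra).
    lra.
  - intros s Hs.
    assert (C1 : c * (kap * Rpower (D (a - k) s) (kap - 1) * Dx (a - k) s) <= 0).
    { assert (N2 : Dx (a - k) s <= 0) by (apply Dneg; lra).
      generalize (Rpower_pos (D (a - k) s) (kap - 1)); intros.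
      rewrite <- !Rmult_assoc, ck.
      assert (0 < p * Rpower (D (a - k) s) (kap - 1)) by (apply Rmult_lt_0_compat; lra); nra. }
    assert (C2 : vx a (s + h) <= vx a s).
    { rewrite !Fr by lra; apply Rpower_neg_decreasing; [lra |].
      assert (v a (s + h) <= v a s) by (apply Hdec; lra).
      assert (v a s < 1) by (apply F1; lra); lra. }
    assert (C3 : vx a s <= vx (a - k) s) by (apply Mx; lra).
    assert (C4 : Rabs (vx (a - k) (s + h) - vx a (s + h)) < eta * h).
    { apply Hd3; try lra.
      - rewrite Rabs_left; lra.
      - rewrite Rminus_diag, Rabs_R0; apply cond_pos. }
    apply Rabs_def2 in C4.
    assert (C5 : Wx (a - k) s <= eta); [| lra].
    unfold Wx; apply Rle_div_l; lra.
  - intros x Hx.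
    assert (C1 : W x tau <= 0).
    { unfold W; apply Rle_div_l; [lra |].
      assert (v x (tau + h) <= v x tau) by (apply Hdec; lra); lra. }
    assert (C2 : Rpower (D x tau) kap <= Rpower (vx 0 tau) kap)
      by (apply Rle_Rpower_l; [lra | apply D0; lra]).
    apply Rmult_le_compat_l with (r := c) in C2; lra. }
assert (E1 : 2 * eta * ((a - k) ^ 2 + 3 * (t - tau)) / (a - k) <= eps / 3).
{ replace (eps / 3) with (eta * L) by (unfold eta; field; lra).
  unfold L; replace (2 * eta * ((a - k) ^ 2 + 3 * (t - tau)) / (a - k))
    with (eta * (2 * ((a - k) ^ 2 + 3 * (t - tau)) / (a - k))) by (field; lra).
  apply Rmult_le_compat_l; [lra |].
  apply Rmult_le_compat; [nra | left; apply Rinv_0_lt_compat; lra | nra |].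
  apply Rinv_le_contravar; lra. }
assert (E2 : Rabs (W 0 t - vt 0 t) < eps / 3) by (apply Hd2; lra).
assert (E3 : Rabs (c * Rpower (D 0 t) kap - c * Rpower (vx 0 t) kap) < eps / 3).
{ destruct (Req_dec (D 0 t) (vx 0 t)) as [E | NE].
  - rewrite E, Rminus_diag, Rabs_R0; exact e3.
  - apply (Hd4 (D 0 t)); split.
    + split; [exact I | intros E; apply NE; symmetry; exact E].
    + unfold D; rewrite Rplus_comm; rewrite Rplus_comm.
      apply (Hd5 k); lra. }
apply Rabs_def2 in E2; apply Rabs_def2 in E3; lra.
Qed.

(** * From the differential inequality to the lower bound *)

Lemma at_left_interval (T t1 : R) (P : R -> Prop) :
  t1 < T -> (forall t, t1 < t < T -> P t) -> at_left T P.
Proof.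
intros H HP; assert (r0 : 0 < T - t1) by lra.
exists (mkposreal _ r0); intros t Ht tT; apply HP; split; [| exact tT].
apply Rabs_def2 in Ht; unfold minus, plus, opp in Ht; simpl in Ht; lra.
Qed.

Lemma quench_ode_lower_bound (y : R -> R) (p c A tau T : R) :
  0 < p -> 0 < c -> 0 < A -> tau < T ->
  (forall t, tau <= t < T -> 0 < y t) ->
  (forall t s, tau <= t <= s -> s < T -> y s <= y t) ->
  (forall t, tau <= t < T -> exists l, is_derive y t l /\
     l <= c * (A - Rpower (y t) (- (2 * p + 1)))) ->
  exists C, 0 < C /\ at_left T (fun t => C * Rpower (T - t) (1 / (2 * p + 2)) <= y t).
Proof.
intros p0 c0 A0 tT Hpos Hdec Hode.
assert (n0 : 0 < 1 / (2 * p + 2)) by (apply Rdiv_lt_0_compat; lra).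
destruct (classic (exists t1, tau <= t1 < T /\ 2 * A <= Rpower (y t1) (- (2 * p + 1))))
  as [[t1 [Ht1 HA]] | NE].
- assert (K0 : 0 < c * (p + 1)) by (apply Rmult_lt_0_compat; lra).
  exists (Rpower (c * (p + 1)) (1 / (2 * p + 2))); split; [apply Rpower_pos |].
  apply at_left_interval with t1; [lra |]; intros t Ht.
  assert (Hd : forall r, t1 <= r < T -> exists l, is_derive (fun r => Rpower (y r) (2 * p + 2)) r l
                 /\ l <= - (c * (p + 1))).
  { intros r Hr; destruct (Hode r) as [l [Hl l1]]; [lra |].
    assert (yr : 0 < y r) by (apply Hpos; lra).
    eexists; split; [apply is_derive_Rpower_comp; [exact yr | exact Hl] |].
    replace (2 * p + 2 - 1) with (2 * p + 1) by ring.
    set (Q := Rpower (y r) (- (2 * p + 1))) in *.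
    assert (HQ : 2 * A <= Q).
    { apply Rle_trans with (1 := HA), Rpower_neg_decreasing; [lra |].
      split; [exact yr | apply Hdec; lra]. }
    assert (E : Rpower (y r) (2 * p + 1) * Q = 1).
    { unfold Q; rewrite Rpower_Ropp; field; apply Rgt_not_eq, Rpower_pos. }
    assert (l2 : l <= - (c / 2) * Q) by nra.
    replace (- (c * (p + 1))) with ((2 * p + 2) * Rpower (y r) (2 * p + 1) * (- (c / 2) * Q)).
    - apply Rmult_le_compat_l; [| exact l2].
      apply Rmult_le_pos; [lra | left; apply Rpower_pos].
    - transitivity (- (c * (p + 1)) * (Rpower (y r) (2 * p + 1) * Q)); [field | rewrite E; ring]. }
  set (E := fun r => Rpower (y r) (2 * p + 2)) in *.
  assert (Ebound : c * (p + 1) * (T - t) <= E t).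
  { apply Rnot_lt_le; intros L.
    assert (E0 : forall r, 0 < E r) by (intros; apply Rpower_pos).
    set (s := t + E t / (c * (p + 1))).
    assert (st : t < s).
    { unfold s; generalize (Rdiv_lt_0_compat _ _ (E0 t) K0); lra. }
    assert (sT : s < T).
    { assert (E t / (c * (p + 1)) < T - t); [| unfold s; lra].
      apply Rlt_div_l; lra. }
    destruct (mean_value E (fun r => Derive E r) t s st) as [r [Hr Er]].
    - intros r Hr; destruct (Hd r) as [l [Hl _]]; [lra |].
      apply Derive_correct; exists l; exact Hl.
    - intros r Hr; destruct (Hd r) as [l [Hl _]]; [lra |].
      exact (is_derive_continuity_pt _ _ _ Hl).
    - destruct (Hd r) as [l [Hl l1]]; [lra |].
      assert (DE : Derive E r = l) by (apply is_derive_unique, Hl).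
      rewrite DE in Er.
      assert (l * (s - t) <= - (c * (p + 1)) * (s - t)) by (apply Rmult_le_compat_r; lra).
      assert (- (c * (p + 1)) * (s - t) = - E t) by (unfold s; field; lra).
      generalize (E0 s); lra. }
  replace (y t) with (Rpower (E t) (1 / (2 * p + 2))).
  + rewrite Rpower_mult_distr by lra.
    apply Rle_Rpower_l; [lra |]; split; [| exact Ebound].
    apply Rmult_lt_0_compat; lra.
  + unfold E; rewrite Rpower_mult.
    replace ((2 * p + 2) * (1 / (2 * p + 2))) with 1 by (field; lra).
    apply Rpower_1, Hpos; lra.
- set (L := Rpower (2 * A) (- (1 / (2 * p + 1)))).
  exists (L / Rpower (T - tau) (1 / (2 * p + 2))); split.
  { apply Rdiv_lt_0_compat; apply Rpower_pos. }
  apply at_left_interval with tau; [exact tT |]; intros t Ht.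
  apply Rle_trans with L.
  + unfold Rdiv at 1; rewrite Rmult_assoc; rewrite <- (Rmult_1_r L) at 2.
    apply Rmult_le_compat_l; [left; apply Rpower_pos |].
    rewrite Rmult_comm; apply Rle_div_l; [apply Rpower_pos |]; rewrite Rmult_1_l.
    apply Rle_Rpower_l; lra.
  + apply Rnot_lt_le; intros N; apply NE; exists t; split; [lra |].
    replace (2 * A) with (Rpower L (- (2 * p + 1))).
    * apply Rpower_neg_decreasing; [lra |]; split; [apply Hpos |]; lra.
    * unfold L; rewrite Rpower_mult.
      replace (- (1 / (2 * p + 1)) * - (2 * p + 1)) with 1 by (field; lra).
      apply Rpower_1; lra.
Qed.

Lemma is_derive_on_ext (D : R -> Prop) (f g : R -> R) (x l : R) :
  (forall y, D y -> f y = g y) -> D x -> is_derive_on D f x l -> is_derive_on D g x l.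
Proof.
intros E Dx; apply filterlim_within_ext; intros y Dy; rewrite !E by assumption; reflexivity.
Qed.

Lemma solution_flow (a p q T S : R) (u0 : R -> R) (u : R -> R -> R) :
  0 < a -> initial_datum a p q u0 -> is_solution a p q T u0 u -> is_quenching_time a T u ->
  (forall x, 0 < x < a -> Derive_n (fun y => u y 0) 2 x <= 0) ->
  0 < S < T ->
  exists v vx vt, heat_flow a p q S v vx vt /\
    (forall x t, 0 <= x <= a -> 0 <= t <= S -> v x t = u x t) /\
    (forall x, 0 < x < a -> exists l, is_derive (fun y => vx y 0) x l /\ l <= 0).
Proof.
intros a0 [_ [_ [u00 [u0a [Hl0 Hr0]]]]] [ux [uxx [ut [[Hd [Hc [Hcx [_ Hct]]]] [Heq [Hl [Hr Hi]]]]]]]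
  [_ [Hb _]] Hxx [S0 ST].
assert (a0' : 0 <= a) by lra.
assert (S0' : 0 <= S < T) by lra.
set (cx := clamp 0 a); set (ct := clamp 0 S).
set (vx := fun x t => ux (cx x) (ct t)).
set (v := fun x t => u (cx x) (ct t) + vx x t * (x - cx x)).
assert (cxid : forall x, 0 <= x <= a -> cx x = x) by (intros; apply clamp_id; assumption).
assert (ctid : forall t, 0 <= t <= S -> ct t = t) by (intros; apply clamp_id; assumption).
assert (vu : forall x t, 0 <= x <= a -> 0 <= t <= S -> v x t = u x t).
{ intros x t Hx Ht; unfold v; rewrite cxid, ctid by assumption; ring. }
assert (vxu : forall x t, 0 <= x <= a -> 0 <= t <= S -> vx x t = ux x t).
{ intros x t Hx Ht; unfold vx; rewrite cxid, ctid by assumption; reflexivity. }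
assert (ctS : forall t, time T (ct t)).
{ intros t; generalize (clamp_bounds 0 S t (proj1 S0')); unfold time, ct; lra. }
assert (Hvx : forall x t, 0 < x < a -> 0 <= t <= S ->
          is_derive (fun y => vx y t) x (uxx x t)).
{ intros x t Hx Ht.
  assert (Hs : space a x) by (unfold space; lra).
  assert (Htt : time T t) by (unfold time; lra).
  apply is_derive_ext_loc with (fun y => ux y t).
  - apply filter_imp with (2 := locally_segment 0 a x Hx); intros y Hy.
    symmetry; apply vxu; assumption.
  - apply (is_derive_on_interior (space a)); [apply locally_segment, Hx |].
    exact (proj1 (proj2 (Hd x t Hs Htt))). }
assert (Hux0 : forall x, space a x -> is_derive_on (space a) u0 x (ux x 0)).
{ intros x Hx; apply is_derive_on_ext with (fun y => u y 0); [exact Hi | exact Hx |].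
  apply Hd; [exact Hx | unfold time; lra]. }
exists v, vx, (fun x t => ut (cx x) (ct t)); split; [split | split; [exact vu |]].
- intros x t; apply continuity_2d_pt_plus.
  + apply (continuity_2d_clamp a S T u); assumption.
  + apply continuity_2d_pt_mult; [apply (continuity_2d_clamp a S T ux); assumption |].
    apply continuity_2d_pt_minus; [apply continuity_2d_pt_id1 |].
    intros eps; exists eps; intros y s Hy _.
    apply Rle_lt_trans with (2 := Hy), clamp_dist.
- intros x t; apply (continuity_2d_clamp a S T ux); assumption.
- intros x t; apply (continuity_2d_clamp a S T ut); assumption.
- intros x t; unfold v, vx, cx.
  apply (is_derive_tangent_ext a (fun x => u x (ct t)) (fun x => ux x (ct t)) a0).
  intros y Hy; exact (proj1 (Hd y (ct t) Hy (ctS t))).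
- intros x t Hx Ht; rewrite cxid, ctid by lra; rewrite Heq by lra; apply Hvx; lra.
- intros x t Hx Ht; rewrite cxid, ctid by lra.
  apply is_derive_ext_loc with (u x).
  + apply filter_imp with (2 := locally_segment 0 S t Ht); intros s Hs.
    symmetry; apply vu; assumption.
  + apply (is_derive_on_interior (time T)).
    * assert (tT : 0 < t < T) by lra.
      apply filter_imp with (2 := locally_segment 0 S t Ht); intros s Hs; unfold time; lra.
    * assert (Htt : time T t) by (unfold time; lra).
      exact (proj2 (proj2 (Hd x t Hx Htt))).
- intros t Ht; rewrite vxu, vu by lra.
  destruct (Rle_lt_or_eq_dec 0 t (proj1 Ht)) as [L | E]; [apply Hl; lra | subst t].
  assert (s0 : space a 0) by (unfold space; lra).
  rewrite (Hi 0 s0).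
  apply (is_derive_on_unique a u0 0); [exact a0 | exact s0 | apply Hux0, s0 | exact Hl0].
- intros t Ht; rewrite vxu, vu by lra.
  destruct (Rle_lt_or_eq_dec 0 t (proj1 Ht)) as [L | E]; [apply Hr; lra | subst t].
  assert (sa : space a a) by (unfold space; lra).
  rewrite (Hi a sa).
  apply (is_derive_on_unique a u0 a); [exact a0 | exact sa | apply Hux0, sa | exact Hr0].
- intros t Ht; rewrite vu by lra.
  destruct (Rle_lt_or_eq_dec 0 t (proj1 Ht)) as [L | E].
  + apply (Hb 0 t); unfold space; lra.
  + subst t; rewrite Hi by (unfold space; lra); exact u00.
- intros t Ht; rewrite vu by lra.
  destruct (Rle_lt_or_eq_dec 0 t (proj1 Ht)) as [L | E].
  + apply (Hb a t); unfold space; lra.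
  + subst t; rewrite Hi by (unfold space; lra); exact u0a.
- intros x Hx; exists (uxx x 0); split; [apply Hvx; lra |].
  replace (uxx x 0) with (Derive_n (fun y => u y 0) 2 x); [apply Hxx, Hx |].
  assert (D2 : is_derive (Derive_n (fun y => u y 0) 1) x (uxx x 0)).
  { apply is_derive_ext_loc with (fun y => vx y 0); [| apply Hvx; lra].
    assert (Lx : locally x (fun y => 0 < y < a)).
    { apply filter_and; [apply (open_gt 0) | apply (open_lt a)]; lra. }
    apply filter_imp with (2 := Lx); intros y Hy.
    assert (Hs : space a y) by (unfold space; lra).
    assert (Htt : time T 0) by (unfold time; lra).
    symmetry; simpl; rewrite vxu by lra; apply is_derive_unique.
    apply (is_derive_on_interior (space a)); [apply locally_segment, Hy |].
    exact (proj1 (Hd y 0 Hs Htt)). }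
  exact (is_derive_unique _ _ _ D2).
Qed.

Theorem theorem3p3 (a p q T : R) (u0 : R -> R) (u : R -> R -> R)
    (ha : 0 < a) (hp : 0 < p) (hq : 0 < q)
    (hu0 : initial_datum a p q u0)
    (hu : is_solution a p q T u0 u)
    (hT : is_quenching_time a T u)
    (hxx : forall x, 0 < x < a -> Derive_n (fun y => u y 0) 2 x <= 0) :
  exists C3 : R, 0 < C3 /\
    at_left T (fun t => C3 * Rpower (T - t) (1 / (2 * p + 2)) <= u 0 t).
Proof.
assert (T0 : 0 < T) by apply hT.
assert (dec : forall x t s, 0 <= x <= a -> 0 < t <= s -> s < T -> u x s <= u x t).
{ intros x t s Hx Hts HsT.
  destruct (solution_flow a p q T ((s + T) / 2) u0 u) as [v [vx [vt [F [vu conc]]]]];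
    try assumption; [lra |].
  rewrite <- !vu by lra.
  apply (flow_decreasing a p q ((s + T) / 2) v vx vt); try assumption; lra. }
apply (quench_ode_lower_bound (u 0) p (p ^ 2 / (2 * p + 1))
  (Rpower (u 0 (T / 2)) (- (2 * p + 1))) (T / 2) T); try assumption; try lra.
- apply Rdiv_lt_0_compat; [apply pow_lt |]; lra.
- apply Rpower_pos.
- intros t Ht; apply (proj1 (proj2 hT)); unfold space; lra.
- intros t s Hts HsT; apply dec; lra.
- intros t Ht.
  destruct (solution_flow a p q T ((t + T) / 2) u0 u) as [v [vx [vt [F [vu conc]]]]];
    try assumption; [lra |].
  assert (Ht' : 0 < t < (t + T) / 2) by lra.
  exists (vt 0 t); split.
  + apply is_derive_ext_loc with (v 0).
    * apply filter_imp with (2 := locally_segment 0 _ t Ht'); intros s Hs; apply vu; lra.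
    * apply (flow_dt _ _ _ _ _ _ _ F); lra.
  + rewrite <- !vu by lra.
    apply (flow_quench_rate a p q ((t + T) / 2) v vx vt); try assumption; try lra.
    intros x r s Hx Hrs Hs; rewrite !vu by lra; apply dec; lra.
Qed.
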